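(* Let $Q_3$ be the $3$-dimensional hypercube graph. Breaker has a winning strategy in the $1$-degree game played on $Q_3$; that is, $\delta_B(Q_3)=1$.
   Context: The graph $Q_3$ has vertex set $\{0,1\}^3$, two vertices being adjacent when they differ in exactly one coordinate. Degree game. Given a graph $G$, two players, Maker and Breaker, alternately claim previously unclaimed edges of $G$, one edge per turn, with Maker moving first, until all edges are claimed. In the $t$-degree game, Breaker wins if at the end every vertex is incident to at least $t$ edges claimed by Breaker; Maker wins if Maker claims at least $\deg_G(x)-t+1$ edges at some vertex $x$. In particular, in the $1$-degree game Breaker wins iff at the end every vertex is incident to at least one edge claimed by Breaker. $\delta_B(G)$ denotes the largest nonnegative integer $t$ for which Breaker has a winning strategy in the $t$-degree game on $G$. *)

(* Defs.v *)
From HB Require Import structures.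
From mathcomp Require Import all_boot.

Set Implicit Arguments.
Unset Strict Implicit.
Unset Printing Implicit Defensive.

Record sgraph := SGraph {
  vertex :> finType;
  adj : rel vertex;
  adj_sym : symmetric adj;
  adj_irr : irreflexive adj }.

Definition edges (G : sgraph) : {set {set G}} :=
  [set [set u.1; u.2] | u : G * G & adj u.1 u.2].

(* A position of the game is the chronological list of the edges claimed so
   far, Maker having claimed those at even indices 0, 2, ... (he moves first)
   and Breaker those at odd indices. *)
Definition position (G : sgraph) (p : seq {set G}) : bool :=
  uniq p && all [in edges G] p.

Definition final (G : sgraph) (p : seq {set G}) : bool :=
  position p && (size p == #|edges G|).

Definition breaker_edges (G : sgraph) (p : seq {set G}) : {set {set G}} :=
  [set f in p | odd (index f p)].

Definition breaker_degree (G : sgraph) (p : seq {set G}) (x : G) : nat :=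
  #|[set f in breaker_edges p | x \in f]|.

(* At the end of a play, the negation of this condition says that Maker has
   claimed at least deg x - t + 1 edges at some vertex x. *)
Definition breaker_wins (G : sgraph) (t : nat) (p : seq {set G}) : Prop :=
  forall x : G, t <= breaker_degree p x.

(* A strategy for Breaker maps the history of the play to his next edge, which
   has to be an unclaimed edge whenever it is his turn and one remains. *)
Definition breaker_strategy (G : sgraph) (s : seq {set G} -> {set G}) : Prop :=
  forall p : seq {set G}, position p -> odd (size p) -> size p < #|edges G| ->
    position (rcons p (s p)).

Definition follows (G : sgraph) (s : seq {set G} -> {set G})
    (p : seq {set G}) : Prop :=
  forall (q : seq {set G}) (f : {set G}) (r : seq {set G}),
    p = q ++ f :: r -> odd (size q) -> f = s q.

Definition breaker_has_winning_strategy (G : sgraph) (t : nat) : Prop :=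
  exists2 s : seq {set G} -> {set G}, breaker_strategy s &
    forall p : seq {set G}, final p -> follows s p -> breaker_wins t p.

(* The relation "delta_B(G) = t".  It is stated as a relation because for a
   graph without vertices no largest t exists. *)
Definition is_delta_B (G : sgraph) (t : nat) : Prop :=
  breaker_has_winning_strategy G t /\
  forall t' : nat, breaker_has_winning_strategy G t' -> t' <= t.

Definition hypercube_adj (d : nat) : rel (d.-tuple bool) :=
  fun x y => #|[set i : 'I_d | tnth x i != tnth y i]| == 1.

Lemma hypercube_adj_sym (d : nat) : symmetric (@hypercube_adj d).
Proof.
move=> x y; rewrite /hypercube_adj; congr (_ == _); apply: eq_card => i.
by rewrite !inE eq_sym.
Qed.

Lemma hypercube_adj_irr (d : nat) : irreflexive (@hypercube_adj d).
Proof.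
move=> x; rewrite /hypercube_adj eq_card0 // => i.
by rewrite !inE eqxx.
Qed.

Definition hypercube (d : nat) : sgraph :=
  SGraph (@hypercube_adj_sym d) (@hypercube_adj_irr d).

(* Main.v *)
(* Upper bound: the edges claimed by Breaker, at most half of all edges, have
   total degree at most #|edges G|, so a win in the t-degree game forces
   t * 8 <= 12 on Q_3.

   Lower bound: call the danger of a vertex 0 if Breaker has touched it and
   3 ^ m if he has not, m being the number of Maker's edges there.  Breaker
   always claims an unclaimed edge whose endpoints maximise twice their own
   danger plus the dangers of their neighbours along unclaimed edges.
   (Without the neighbours' contribution the greedy rule loses for some ways
   of breaking ties.)  Against this fixed strategy there are few enough plays
   to evaluate them all, each being cut off as soon as Breaker has touched
   every vertex. *)
Require Import Defs.
From mathcomp Require Import all_boot.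

Set Implicit Arguments.
Unset Strict Implicit.
Unset Printing Implicit Defensive.

(** * Plays against a strategy and the upper bound *)

Section Plays.
Variables (G : sgraph) (s : seq {set G} -> {set G}).
Hypothesis strat : breaker_strategy s.

Lemma position_catl (p q : seq {set G}) : position (p ++ q) -> position p.
Proof. by rewrite /position cat_uniq all_cat => /andP[/andP[-> _] /andP[->]]. Qed.

Lemma position_extend (p : seq {set G}) :
  position p -> size p < #|edges G| -> exists e, position (rcons p e).
Proof.
move=> /andP[up pE] ltpE.
have [e eE ep] : exists2 e, e \in edges G & e \notin p.
  apply/subsetPn; apply: contraTN ltpE => /subset_leq_card.
  by rewrite -leqNgt (card_uniqP up).
by exists e; rewrite /position rcons_uniq ep up all_rcons pE /= eE.
Qed.

Lemma follows_rcons (p : seq {set G}) (e : {set G}) :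
  follows s p -> (odd (size p) -> e = s p) -> follows s (rcons p e).
Proof.
move=> fp pe q f r; case: (lastP r) => [|r' g].
  by rewrite cats1 => /rcons_inj[<- <-].
by rewrite -rcons_cons -rcons_cat => /rcons_inj[p_eq _]; apply: fp p_eq.
Qed.

(** A win is a statement about all final plays that follow the strategy, so a contradiction needs
    one such play. It is built edge by edge, Maker taking any unclaimed edge. *)
Lemma follows_final : exists2 p, final p & follows s p.
Proof.
suff reach n : n <= #|edges G| ->
    exists p, [/\ position p, size p = n & follows s p].
  by have [p [pp sp fp]] := reach _ (leqnn _); exists p; rewrite // /final pp sp eqxx.
elim: n => [_|n IHn lt_nE]; first by exists [::]; split=> // -[].
have [p [pp sp fp]] := IHn (ltnW lt_nE).
have [e pe p_odd] : exists2 e, position (rcons p e) & odd (size p) -> e = s p.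
  case: (boolP (odd (size p))) => odd_p.
    by exists (s p) => //; apply: strat => //; rewrite sp.
  by have [|e pe] := position_extend pp; [rewrite sp | exists e; rewrite ?(negPf odd_p)].
by exists (rcons p e); split; rewrite ?size_rcons ?sp //; apply: follows_rcons.
Qed.

End Plays.

(** Each of Breaker's edges stands at some index [i.*2.+1], and [i] ranges below half the length. *)
Lemma leq_card_breaker_edges (G : sgraph) (p : seq {set G}) :
  #|breaker_edges p| <= (size p)./2.
Proof.
pose odd_move (i : 'I_(size p)./2) := nth set0 p i.*2.+1.
apply: leq_trans (_ : #|odd_move @: 'I_(size p)./2| <= _); last first.
  by rewrite -[leqRHS]card_ord leq_imset_card.
apply/subset_leq_card/subsetP => f; rewrite inE => /andP[fp odd_f].
have def_f := odd_double_half (index f p); rewrite odd_f add1n in def_f.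
have lt_f : (index f p)./2 < (size p)./2.
  have := fp; rewrite -index_mem => /half_leq.
  by rewrite -[in X in X -> _]def_f -doubleS doubleK.
by apply/imsetP; exists (Ordinal lt_f); rewrite ?inE // /odd_move /= def_f nth_index.
Qed.

(* Double counting: the Breaker degrees add up to at most twice the number of
   Breaker's edges. *)
Lemma winning_strategy_leq_edges (G : sgraph) (t : nat) :
  breaker_has_winning_strategy G t -> t * #|G| <= #|edges G|.
Proof.
case=> s strat win; have [p fin_p fol_p] := follows_final strat.
have {}win := win p fin_p fol_p.
have /andP[/andP[_ /allP pE] /eqP sp] := fin_p.
have le_deg : \sum_(x : G) t <= \sum_(x : G) breaker_degree p x.
  by apply: leq_sum => x _; apply: win.
rewrite sum_nat_const mulnC in le_deg; apply: leq_trans le_deg _.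
have -> : \sum_(x : G) breaker_degree p x = \sum_(f in breaker_edges p) #|f|.
  under eq_bigr do rewrite /breaker_degree -sum1dep_card big_mkcondr /=.
  rewrite exchange_big /=; apply: eq_bigr => f _.
  by rewrite -big_mkcond sum1_card.
apply: leq_trans (_ : \sum_(f in breaker_edges p) 2 <= _).
  apply: leq_sum => f; rewrite inE => /andP[/pE/imsetP[u _ ->] _].
  by rewrite cards2; case: (_ != _).
rewrite sum_nat_const muln2 -sp.
apply: leq_trans (_ : (size p)./2.*2 <= _).
  by rewrite leq_double leq_card_breaker_edges.
by rewrite -[leqRHS]odd_double_half leq_addl.
Qed.

(** * A computable encoding of the edges of $Q_3$ *)

Definition cube_edges : seq (nat * nat) :=
  [:: (0, 1); (0, 2); (0, 4); (1, 3); (1, 5); (2, 3); (2, 6); (3, 7);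
      (4, 5); (4, 6); (5, 7); (6, 7)].

(* The vertices of [Q_3] are numbered by reading them in binary. *)
Definition cube_vertex (n : nat) : hypercube 3 :=
  [tuple odd n; odd n./2; odd n./2./2].

Definition cube_edge (e : nat * nat) : {set hypercube 3} :=
  [set cube_vertex e.1; cube_vertex e.2].

(** Inverse of [cube_edge] on the edges. On any other set the default [(0, 0)] results, which codes
    no edge. *)
Definition edge_code (f : {set hypercube 3}) : nat * nat :=
  nth (0, 0) cube_edges (index f (map cube_edge cube_edges)).

Lemma cube_vertex_surj (x : hypercube 3) : exists2 n, n < 8 & x = cube_vertex n.
Proof.
case: x => [[|a [|b [|c []]]] // sz]; exists (a + b.*2 + c.*2.*2).
  by case: a b c {sz} => [] [] [].
by apply/val_inj; case: a b c sz => [] [] [].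
Qed.

Lemma adj_cube_vertex (a b : nat) : a < 8 -> b < 8 ->
  adj (cube_vertex a) (cube_vertex b) =
    ((a, b) \in cube_edges) || ((b, a) \in cube_edges).
Proof.
move=> lt_a lt_b; rewrite /= /hypercube_adj -sum1dep_card big_mkcond.
rewrite !big_ord_recl big_ord0 !(tnth_nth false) /=.
have : all (fun a => all (fun b =>
    (((if odd a != odd b then 1 else 0) + ((if odd a./2 != odd b./2 then 1 else 0) +
     ((if odd a./2./2 != odd b./2./2 then 1 else 0) + 0)) == 1) ==
    (((a, b) \in cube_edges) || ((b, a) \in cube_edges)))) (iota 0 8)) (iota 0 8).
  by vm_compute.
by move=> /allP/(_ a); rewrite mem_iota lt_a => /(_ isT)/allP/(_ b);
  rewrite mem_iota lt_b => /(_ isT)/eqP.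
Qed.

Lemma cube_edge_uniq : uniq (map cube_edge cube_edges).
Proof.
(* Distinct traces force distinct sets. Traces are boolean lists, so the evaluation only compares
   tuples and never unfolds a finite set. *)
pose trace (f : {set hypercube 3}) := [seq cube_vertex n \in f | n <- iota 0 8].
apply: (@map_uniq _ _ trace); rewrite -map_comp.
rewrite (eq_map (_ : _ =1 fun e => [seq (cube_vertex n == cube_vertex e.1)
    || (cube_vertex n == cube_vertex e.2) | n <- iota 0 8])); last first.
  by move=> e; apply: eq_map => n; rewrite in_set2.
by vm_compute.
Qed.

Lemma mem_edges_cube (f : {set hypercube 3}) :
  (f \in edges (hypercube 3)) = (f \in map cube_edge cube_edges).
Proof.
apply/imsetP/mapP => [[[x y] + ->]|[[a b] abE ->]].
  have [a lt_a ->] := cube_vertex_surj x; have [b lt_b ->] := cube_vertex_surj y.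
  rewrite inE (adj_cube_vertex lt_a lt_b) => /orP[] abE; first by exists (a, b).
  by exists (b, a); rewrite // /cube_edge setUC.
exists (cube_vertex a, cube_vertex b) => //.
have /andP[lt_a lt_b] : (a < 8) && (b < 8).
  by apply: (allP (_ : all (fun e => (e.1 < 8) && (e.2 < 8)) cube_edges) (a, b)).
by rewrite inE (adj_cube_vertex lt_a lt_b) abE.
Qed.

Lemma card_edges_cube : #|edges (hypercube 3)| = 12.
Proof.
by rewrite (eq_card mem_edges_cube) (card_uniqP cube_edge_uniq).
Qed.

Lemma cube_edgeK : {in cube_edges, cancel cube_edge edge_code}.
Proof.
move=> e eE; rewrite /edge_code -{1}(nth_index (0, 0) eE).
rewrite -(nth_map _ set0) ?index_mem // index_uniq ?cube_edge_uniq //.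
  exact: nth_index.
by rewrite size_map index_mem.
Qed.

Lemma edge_codeK : {in edges (hypercube 3), cancel edge_code cube_edge}.
Proof. by move=> f; rewrite mem_edges_cube => /mapP[e eE ->]; rewrite cube_edgeK. Qed.

Lemma edge_code_mem (f : {set hypercube 3}) :
  f \in edges (hypercube 3) -> edge_code f \in cube_edges.
Proof. by rewrite mem_edges_cube => /mapP[e eE ->]; rewrite cube_edgeK. Qed.

Lemma cube_edge_inj : {in cube_edges &, injective cube_edge}.
Proof. exact: can_in_inj cube_edgeK. Qed.

Lemma edge_code_inj : {in edges (hypercube 3) &, injective edge_code}.
Proof. exact: can_in_inj edge_codeK. Qed.

(** * Breaker's greedy rule on codes and its exhaustive check *)

Definition incident (x : nat) (e : nat * nat) : bool := (x == e.1) || (x == e.2).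

Definition unclaimed (h : seq (nat * nat)) : seq (nat * nat) :=
  [seq e <- cube_edges | e \notin h].

Definition maker_moves (h : seq (nat * nat)) : seq (nat * nat) :=
  [seq e <- h | ~~ odd (index e h)].

Definition breaker_moves (h : seq (nat * nat)) : seq (nat * nat) :=
  [seq e <- h | odd (index e h)].

Definition covers (s : seq (nat * nat)) : bool :=
  all (fun x => has (incident x) s) (iota 0 8).

Definition danger (maker breaker : seq (nat * nat)) (x : nat) : nat :=
  if has (incident x) breaker then 0 else 3 ^ count (incident x) maker.

(* [nth 0 (mkseq _ 8)] tabulates a function on the vertices, so that each value
   is computed only once. *)
Definition priorities (h : seq (nat * nat)) : seq (nat * (nat * nat)) :=
  let u := unclaimed h in
  let d := nth 0 (mkseq (danger (maker_moves h) (breaker_moves h)) 8) in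
  let w := nth 0 (mkseq (fun x => 2 * d x + sumn [seq d e.2 | e <- u & e.1 == x]
                                  + sumn [seq d e.1 | e <- u & e.2 == x]) 8) in
  [seq (w e.1 + w e.2, e) | e <- u].

(** The sort is decreasing and stable, so ties go to the edge that comes first in [cube_edges]. *)
Definition reply (h : seq (nat * nat)) : nat * nat :=
  (head (0, (0, 0)) (sort (relpre fst geq) (priorities h))).2.

Lemma reply_unclaimed (e : nat * nat) (h : seq (nat * nat)) :
  e \in unclaimed h -> reply h \in unclaimed h.
Proof.
move=> eh; rewrite /reply -nth0; set l := sort _ _.
have /(mem_nth (0, (0, 0))) : 0 < size l.
  by rewrite size_sort size_map; case: unclaimed eh.
by rewrite mem_sort => /mapP[f fh ->].
Qed.

(* The nested conditionals, unlike [||], let [vm_compute] skip the recursive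
   call. *)
Fixpoint replies_win (n : nat) (h : seq (nat * nat)) : bool :=
  if covers (breaker_moves h) then true
  else if n is n'.+1 then
    all (fun e => let h' := rcons h e in replies_win n' (rcons h' (reply h')))
      (unclaimed h)
  else false.

(** Appending moves keeps the index, hence the owner, of every earlier edge. This justifies cutting
    off a play once Breaker has touched all vertices. *)
Lemma covers_cat (h q : seq (nat * nat)) :
  covers (breaker_moves h) -> covers (breaker_moves (h ++ q)).
Proof.
move=> /allP cov; apply/allP => x /cov/hasP[e].
rewrite mem_filter => /andP[odd_e eh] xe; apply/hasP; exists e => //.
by rewrite mem_filter mem_cat index_cat eh odd_e.
Qed.

(** Induction on the number [n] of remaining rounds, a round being a move of Maker and the reply to
    it; [q] is the rest of the play after [h]. *)
Lemma replies_win_covers (n : nat) (h q : seq (nat * nat)) :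
    replies_win n h -> ~~ odd (size h) -> size q = n.*2 ->
    uniq (h ++ q) -> {subset q <= cube_edges} ->
    (forall h1 e h2, h ++ q = h1 ++ e :: h2 -> odd (size h1) -> e = reply h1) ->
  covers (breaker_moves (h ++ q)).
Proof.
elim: n h q => [|n IHn] h q /=; case: ifP => [cov|_] // win even_h.
- by move=> *; apply: covers_cat.
- by move=> *; apply: covers_cat.
case: q => [|m [|b q]] //= [size_q] uniq_q sub_q fol.
have mh : m \in unclaimed h.
  rewrite mem_filter sub_q ?mem_head // andbT.
  by move: uniq_q; rewrite cat_uniq /= negb_or => /and3P[_ /andP[]].
have def_b : b = reply (rcons h m).
  by apply: (fol _ _ q); rewrite ?cat_rcons // size_rcons /= even_h.
rewrite -!cat_rcons; rewrite -!cat_rcons in uniq_q fol.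
apply: IHn => //.
- by rewrite def_b; apply: (allP win).
- by rewrite !size_rcons /= negbK.
- by move=> e eq; rewrite sub_q // !inE eq !orbT.
Qed.

(** Six rounds exhaust the 12 edges. *)
Lemma replies_win_initially : replies_win 6 [::].
Proof. by vm_compute. Qed.

(** * Transfer from codes to the game on $Q_3$ *)

Definition cube_strategy (p : seq {set hypercube 3}) : {set hypercube 3} :=
  cube_edge (reply (map edge_code p)).

Lemma cube_reply_unclaimed (p : seq {set hypercube 3}) :
  position p -> size p < #|edges (hypercube 3)| ->
  reply (map edge_code p) \in unclaimed (map edge_code p).
Proof.
move=> pp lt_p; have [e] := position_extend pp lt_p.
rewrite /position rcons_uniq all_rcons => /andP[/andP[ep _] /andP[eE /allP pE]].
apply: (@reply_unclaimed (edge_code e)); rewrite mem_filter edge_code_mem // andbT.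
apply: contra ep => /mapP[f fp eq_ef].
by rewrite (edge_code_inj eE (pE f fp) eq_ef).
Qed.

Lemma cube_strategy_legal : breaker_strategy cube_strategy.
Proof.
move=> p pp _ lt_p; have := cube_reply_unclaimed pp lt_p.
case/andP: pp => up pE; rewrite mem_filter => /andP[rp rE].
have sE : cube_strategy p \in edges (hypercube 3) by rewrite mem_edges_cube; apply: map_f rE.
rewrite /position rcons_uniq all_rcons up pE /= sE !andbT.
by apply: contra rp => /(map_f edge_code); rewrite cube_edgeK.
Qed.

Lemma cube_strategy_wins (p : seq {set hypercube 3}) :
  final p -> follows cube_strategy p -> breaker_wins 1 p.
Proof.
case/andP=> pp /eqP size_p fol x; have /andP[up /allP pE] := pp.
set h := map edge_code p.
have uniq_h : uniq h.
  by rewrite map_inj_in_uniq; [exact: up | by move=> f g /pE fE /pE; apply: edge_code_inj].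
have : covers (breaker_moves h).
  apply: (@replies_win_covers 6 [::] h replies_win_initially) => //.
  - by rewrite size_map size_p card_edges_cube.
  - by move=> _ /mapP[f /pE fE ->]; apply: edge_code_mem.
  rewrite cat0s => h1 e h2 def_h odd_h1.
  (* Cutting [p] where [h] is cut lets [fol] speak about the coded move [e]. *)
  have def_p : p = take (size h1) p ++ drop (size h1) p by rewrite cat_take_drop.
  have size_h1 : size h1 < size p.
    by rewrite -(size_map edge_code) -/h def_h size_cat /= -addSnnS leq_addr.
  have take_p : map edge_code (take (size h1) p) = h1.
    by rewrite map_take -/h def_h take_size_cat.
  have size_take_p : size (take (size h1) p) = size h1 by rewrite size_take size_h1.
  have pos_take : position (take (size h1) p).
    by apply: (@position_catl _ _ (drop (size h1) p)); rewrite -def_p.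
  rewrite (drop_nth set0 size_h1) in def_p.
  have := fol _ _ _ def_p; rewrite size_take_p => /(_ odd_h1) /(congr1 edge_code).
  (* Decoding the reply is only valid for a code in [cube_edges]; legality of the reply supplies
     this. *)
  rewrite /cube_strategy take_p cube_edgeK.
    by rewrite -(nth_map set0 (0, 0)) // -/h def_h nth_cat ltnn subnn.
  have := cube_reply_unclaimed pos_take.
  by rewrite size_take_p -size_p take_p mem_filter => /(_ size_h1) /andP[].
have [n lt_n -> /allP/(_ n)] := cube_vertex_surj x.
rewrite mem_iota => /(_ lt_n)/hasP[e]; rewrite mem_filter => /andP[odd_e eh] ne.
have [f fp def_e] := mapP eh.
rewrite /breaker_degree card_gt0; apply/set0Pn; exists f; rewrite !inE fp.
(* Coding preserves indices because the codes are distinct, so [f] belongs to Breaker just as [e]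
   does. *)
have def_index : index e h = index f p.
  rewrite def_e -[in edge_code _](nth_index set0 fp) -(nth_map set0 (0, 0)) ?index_mem //.
  by rewrite index_uniq // size_map index_mem.
rewrite -def_index odd_e /= -(edge_codeK (pE _ fp)) -def_e !inE.
by case/orP: ne => /eqP->; rewrite eqxx ?orbT.
Qed.

Theorem lemma6 :
  breaker_has_winning_strategy (hypercube 3) 1 /\ is_delta_B (hypercube 3) 1.
Proof.
have win : breaker_has_winning_strategy (hypercube 3) 1.
  by exists cube_strategy; [exact: cube_strategy_legal | exact: cube_strategy_wins].
split=> //; split=> // t /winning_strategy_leq_edges.
(* For [t] at least 2 the bound would give 16 <= 12. *)
by rewrite card_edges_cube card_tuple card_bool; case: t => [|[|t]].
Qed.
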